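(* Let $\vec{R} = (R_n : n \in \omega)$ be a computable sequence of subsets of $\omega$ such that there is no computable $\vec{R}$-cohesive set. Then no $3$-generic set $G \subseteq \omega$ computes an $\vec{R}$-cohesive set; that is, for every $3$-generic $G$ there is no $\vec{R}$-cohesive set $C$ with $C \leq_T G$.
   Context: A sequence $\vec{R} = (R_n : n\in\omega)$ of subsets of $\omega$ is computable if it is uniformly computable, i.e. the relation $\{(n,x) : x \in R_n\}$ is computable. For sets $X,Y$, write $X \subseteq^* Y$ if $X - Y$ is finite. An infinite set $X \subseteq \omega$ is $\vec{R}$-cohesive if for every $n$ either $X \subseteq^* R_n$ or $X \subseteq^* \omega - R_n$. A set $G$ (identified with an element of $2^\omega$) is $3$-generic (in the sense of Cohen forcing) if for every $\Sigma^0_3$ set $W \subseteq 2^{<\omega}$ there is an initial segment $\sigma$ of $G$ such that either $\sigma \in W$ or no extension of $\sigma$ belongs to $W$. *)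

(* Defs.v *)
From mathcomp Require Import all_boot.
From mathcomp Require Import boolp classical_sets functions cardinality.
From Stdlib Require Cantor.

Set Implicit Arguments.
Unset Strict Implicit.
Unset Printing Implicit Defensive.

Local Open Scope classical_set_scope.

(* Cantor pairing, used to treat functions of several arguments as unary. *)
Definition npair (x y : nat) : nat := Cantor.to_nat (x, y).
Definition nfst (p : nat) : nat := (Cantor.of_nat p).1.
Definition nsnd (p : nat) : nat := (Cantor.of_nat p).2.

(* Partial functions from nat to nat are represented by their graphs. *)
Definition graph := nat -> nat -> Prop.

(* Programs for unary oracle mu-recursive functions; with the pairing and
   projections these yield the recursive functions of every arity. *)
Inductive code : Type :=
| Zero
| Succ
| Fst
| Snd
| Oracle
| Pair of code & code
| Comp of code & code
| Prec of code & code
| Mu of code.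

(* [prec_graph F G a] is the graph of the function h with h(0) = F(a) and
   h(k+1) = G(<a, <k, h(k)>>). *)
Fixpoint prec_graph (F G : graph) (a k y : nat) : Prop :=
  if k is k'.+1 then
    exists u, prec_graph F G a k' u /\ G (npair a (npair k' u)) y
  else F a y.

(* [eval O c n y]: on input n and with the (partial) oracle O, the program c
   halts with output y. *)
Fixpoint eval (O : graph) (c : code) (n y : nat) : Prop :=
  match c with
  | Zero => y = 0
  | Succ => y = n.+1
  | Fst => y = nfst n
  | Snd => y = nsnd n
  | Oracle => O n y
  | Pair c1 c2 => exists u v, [/\ eval O c1 n u, eval O c2 n v & y = npair u v]
  | Comp c1 c2 => exists u, eval O c2 n u /\ eval O c1 u y
  | Prec c1 c2 => prec_graph (eval O c1) (eval O c2) (nfst n) (nsnd n) y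
  | Mu c1 => eval O c1 (npair n y) 0 /\
      forall i, i < y -> exists k, eval O c1 (npair n i) k.+1
  end.

Definition chi (A : set nat) : graph := fun x y => y = nat_of_bool (x \in A).

Definition decidable_in (O : graph) (B : set nat) : Prop :=
  exists c, forall x y, chi B x y -> eval O c x y.

Definition turing_le (B A : set nat) : Prop := decidable_in (chi A) B.

(* With the nowhere defined oracle, any query diverges, so that [eval] yields
   exactly the partial recursive functions. *)
Definition computable (B : set nat) : Prop :=
  decidable_in (fun _ _ => False) B.

Definition computable_seq (R : nat -> set nat) : Prop :=
  computable [set p | R (nfst p) (nsnd p)].

Definition almost_subset (X Y : set nat) : Prop := finite_set (X `\` Y).

Definition cohesive (R : nat -> set nat) (X : set nat) : Prop :=
  infinite_set X /\
  forall n, almost_subset X (R n) \/ almost_subset X (~` R n).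

(* Bijective base-2 coding of finite binary strings, first bit lowest. *)
Fixpoint string_code (s : seq bool) : nat :=
  if s is b :: s' then (string_code s').*2 + b.+1 else 0.

Definition Sigma03 (W : set (seq bool)) : Prop :=
  exists D : set nat, computable D /\
    forall s, W s <-> exists x, forall y, exists z,
      D (npair (string_code s) (npair x (npair y z))).

Definition initial_segment (A : set nat) (n : nat) : seq bool :=
  mkseq (fun i => i \in A) n.

Definition three_generic (G : set nat) : Prop :=
  forall W : set (seq bool), Sigma03 W ->
    exists n, W (initial_segment G n) \/
      forall t, prefix (initial_segment G n) t -> ~ W t.

(* Main.v *)
Require Import Defs.
From mathcomp Require Import all_boot.
From mathcomp Require Import boolp classical_sets functions cardinality.
From Stdlib Require Cantor.

(* Let [C] be the cohesive set computed from [G] by the program [c], and call a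
   string [a] deciding for [R n] if, for some bound [k] and some side, no extension
   of [a] makes [c] enumerate an element above [k] on the other side of [R n];
   this is a Pi_1 condition on [a], [k] and the side. Genericity gives an initial
   segment [a0] of [G] above which strings forcing new elements into [C] are dense,
   and so are, for every [n], the strings deciding for [R n]: the strings above
   which the latter fails for some [n] form a Sigma_3 set that [G] avoids, since
   [C] is cohesive. Above [a0] one builds a computable cohesive set. Guess, at
   stage [s], an increasing chain of strings deciding for [R 0], [R 1], ...,
   always taking the least triple of string, bound and side not yet refuted;
   each guess settles in the limit. Then enumerate a new
   larger element forced in by some extension of the stage [s] chain. From some
   stage on all elements so enumerated lie on the side fixed by the settled
   guess for [R n]. *)

Set Implicit Arguments.
Unset Strict Implicit.
Unset Printing Implicit Defensive.

(** * Cantor pairing *)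

Lemma nfst_npair x y : nfst (npair x y) = x.
Proof. by rewrite /nfst /npair Cantor.cancel_of_to. Qed.

Lemma nsnd_npair x y : nsnd (npair x y) = y.
Proof. by rewrite /nsnd /npair Cantor.cancel_of_to. Qed.

Lemma npairK p : npair (nfst p) (nsnd p) = p.
Proof. by rewrite /nfst /nsnd /npair -surjective_pairing Cantor.cancel_to_of. Qed.

Definition npairE := (nfst_npair, nsnd_npair).

Lemma npair_ge x y : y + x <= npair x y.
Proof. by apply/leP; apply: Cantor.to_nat_non_decreasing. Qed.

Lemma nsnd_le p : nsnd p <= p.
Proof. by rewrite -{2}(npairK p) (leq_trans (leq_addr _ _) (npair_ge _ _)). Qed.

(** * Total recursive functions *)

Definition recursive (f : nat -> nat) :=
  exists c, forall n, eval (fun _ _ => False) c n (f n).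

Lemma eq_recursive f g : f =1 g -> recursive f -> recursive g.
Proof. by move=> fg [c cP]; exists c => n; rewrite -fg. Qed.

Lemma recursive_id : recursive id.
Proof.
by exists (Pair Fst Snd) => n; exists (nfst n), (nsnd n); rewrite npairK.
Qed.

Lemma recursive_comp f g :
  recursive f -> recursive g -> recursive (fun n => f (g n)).
Proof. by move=> [c cP] [d dP]; exists (Comp c d) => n; exists (g n). Qed.

Lemma recursive_S f : recursive f -> recursive (fun n => (f n).+1).
Proof. by apply: recursive_comp; exists Succ. Qed.

Lemma recursive_nfst f : recursive f -> recursive (fun n => nfst (f n)).
Proof. by apply: recursive_comp; exists Fst. Qed.

Lemma recursive_nsnd f : recursive f -> recursive (fun n => nsnd (f n)).
Proof. by apply: recursive_comp; exists Snd. Qed.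

Lemma recursive_const k : recursive (fun=> k).
Proof. by elim: k => [|k IH]; [exists Zero | apply: recursive_S]. Qed.

Lemma recursive_npair f g :
  recursive f -> recursive g -> recursive (fun n => npair (f n) (g n)).
Proof. by move=> [c cP] [d dP]; exists (Pair c d) => n; exists (f n), (g n). Qed.

Fixpoint natrec (b : nat) (st : nat -> nat -> nat) (k : nat) : nat :=
  if k is k'.+1 then st k' (natrec b st k') else b.

Lemma recursive_natrec b st k :
  recursive b ->
  recursive (fun p => st (nfst p) (nfst (nsnd p)) (nsnd (nsnd p))) ->
  recursive k -> recursive (fun n => natrec (b n) (st n) (k n)).
Proof.
move=> [c cP] [d dP] rk.
have rh : recursive (fun p => natrec (b (nfst p)) (st (nfst p)) (nsnd p)).
  exists (Prec c d) => p /=.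
  elim: (nsnd p) => [|i IH] //=.
  exists (natrec (b (nfst p)) (st (nfst p)) i); split=> //.
  by have := dP (npair (nfst p) (npair i (natrec (b (nfst p)) (st (nfst p)) i)));
    rewrite !npairE.
apply: (eq_recursive _ (recursive_comp rh (recursive_npair recursive_id rk))).
by move=> n; rewrite !npairE.
Qed.

Definition recursive2 (F : nat -> nat -> nat) :=
  recursive (fun p => F (nfst p) (nsnd p)).

Lemma recursive2_comp F f g : recursive2 F -> recursive f -> recursive g ->
  recursive (fun n => F (f n) (g n)).
Proof.
move=> rF rf rg; apply: (eq_recursive _ (recursive_comp rF (recursive_npair rf rg))).
by move=> n; rewrite !npairE.
Qed.

(** Classical least witness, with default value [0]; where a witness exists it agrees with the
    search performed by [Mu]. *)
Definition mu (P : nat -> bool) : nat :=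
  if pselect (exists n, P n) is left exP then ex_minn exP else 0.

Lemma muP (P : nat -> bool) n : P n -> P (mu P) /\ mu P <= n.
Proof.
rewrite /mu => Pn; case: pselect => [exP|[]]; last by exists n.
by case: ex_minnP => m Pm min_m; split=> //; apply: min_m.
Qed.

Lemma recursive_mu (P : nat -> nat -> bool) : (forall n, exists i, P n i) ->
  recursive2 (fun n i => P n i) -> recursive (fun n => mu (P n)).
Proof.
move=> exP rP.
(* [Mu] searches for the value [0], so the truth value is negated: [false] gives [1] and [true]
   gives [0]. *)
have [c cP] : recursive (fun p => natrec 1 (fun _ _ => 0) (P (nfst p) (nsnd p))).
  by apply: recursive_natrec; [exact: recursive_const | exact: recursive_const |].
exists (Mu c) => n /=; have [i Pi] := exP n; have [Pmu _] := muP Pi; split.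
  by have := cP (npair n (mu (P n))); rewrite !npairE Pmu.
move=> j j_lt; exists 0; have := cP (npair n j); rewrite !npairE.
by case Pj: (P n j) => //; have [_] := muP Pj; rewrite leqNgt j_lt.
Qed.

Ltac rec_core := first
  [ exact: recursive_const | exact: recursive_id
  | apply: recursive_S | apply: recursive_nfst | apply: recursive_nsnd
  | apply: recursive_npair | eassumption ].

Lemma recursive_pred f : recursive f -> recursive (fun n => (f n).-1).
Proof.
move=> rf; apply: (@eq_recursive (fun n => natrec 0 (fun i _ => i) (f n))).
  by move=> n; case: (f n).
by apply: recursive_natrec; repeat rec_core.
Qed.

Lemma recursive_add f g :
  recursive f -> recursive g -> recursive (fun n => f n + g n).
Proof.
move=> rf rg; apply: (@eq_recursive (fun n => natrec (f n) (fun _ => S) (g n))).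
  by move=> n; elim: (g n) => [|k IH] /=; rewrite ?addn0 // addnS -IH.
by apply: recursive_natrec; repeat rec_core.
Qed.

Lemma recursive_sub f g :
  recursive f -> recursive g -> recursive (fun n => f n - g n).
Proof.
move=> rf rg; apply: (@eq_recursive (fun n => natrec (f n) (fun _ => predn) (g n))).
  by move=> n; elim: (g n) => [|k IH] /=; rewrite ?subn0 // subnS -IH.
by apply: recursive_natrec; repeat first [rec_core | apply: recursive_pred].
Qed.

Lemma recursive_if (b : nat -> bool) f g : recursive (fun n => b n) ->
  recursive f -> recursive g -> recursive (fun n => if b n then f n else g n).
Proof.
move=> rb rf rg; apply: (@eq_recursive (fun n => natrec (g n) (fun _ _ => f n) (b n))).
  by move=> n; case: (b n).
by apply: recursive_natrec; repeat rec_core; apply: recursive_comp rf _; repeat rec_core.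
Qed.

Lemma recursive_leq f g :
  recursive f -> recursive g -> recursive (fun n => f n <= g n).
Proof.
move=> rf rg; apply: (@eq_recursive (fun n => 1 - (f n - g n))).
  by move=> n; rewrite /leq; case: (f n - g n).
by repeat first [rec_core | apply: recursive_sub].
Qed.

Lemma recursive_neg (b : nat -> bool) :
  recursive (fun n => b n) -> recursive (fun n => ~~ b n).
Proof.
move=> rb; apply: (@eq_recursive (fun n => 1 - b n)); first by move=> n; case: (b n).
by repeat first [rec_core | apply: recursive_sub].
Qed.

Lemma recursive_and (b d : nat -> bool) : recursive (fun n => b n) ->
  recursive (fun n => d n) -> recursive (fun n => b n && d n).
Proof.
move=> rb rd; apply: (@eq_recursive (fun n => if b n then nat_of_bool (d n) else 0)).
  by move=> n; case: (b n).
by apply: recursive_if; repeat rec_core.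
Qed.

Lemma recursive_or (b d : nat -> bool) : recursive (fun n => b n) ->
  recursive (fun n => d n) -> recursive (fun n => b n || d n).
Proof.
move=> rb rd; apply: (@eq_recursive (fun n => if b n then 1 else nat_of_bool (d n))).
  by move=> n; case: (b n).
by apply: recursive_if; repeat rec_core.
Qed.

Lemma recursive_eqn f g :
  recursive f -> recursive g -> recursive (fun n => f n == g n).
Proof.
move=> rf rg; apply: (@eq_recursive (fun n => (f n <= g n) && (g n <= f n))).
  by move=> n; rewrite eqn_leq.
by apply: recursive_and; apply: recursive_leq.
Qed.

Lemma recursive_eqb (b d : nat -> bool) : recursive (fun n => b n) ->
  recursive (fun n => d n) -> recursive (fun n => b n == d n).
Proof.
move=> rb rd; apply: (@eq_recursive (fun n => nat_of_bool (b n) == nat_of_bool (d n))).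
  by move=> n; case: (b n); case: (d n).
by apply: recursive_eqn.
Qed.

Lemma recursive_has (P : nat -> nat -> bool) k :
  recursive2 (fun n i => P n i) -> recursive k ->
  recursive (fun n => has (P n) (iota 0 (k n))).
Proof.
move=> rP rk; apply: (@eq_recursive (fun n =>
  natrec 0 (fun i acc => (acc == 1) || P n i) (k n))).
  move=> n; elim: (k n) => // i IH; rewrite -[in RHS]addn1 iotaD has_cat /=.
  by rewrite IH orbF; case: (has _ _).
apply: recursive_natrec => //; first exact: recursive_const.
apply: recursive_or; first by apply: recursive_eqn; repeat rec_core.
by apply: (recursive2_comp rP); repeat rec_core.
Qed.

Lemma recursive_odd f : recursive f -> recursive (fun n => odd (f n)).
Proof.
move=> rf; apply: (@eq_recursive (fun n => natrec 0 (fun _ acc => 1 - acc) (f n))).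
  by move=> n; elim: (f n) => //= k ->; case: (odd k).
by apply: recursive_natrec; repeat first [rec_core | apply: recursive_sub].
Qed.

Lemma recursive_half f : recursive f -> recursive (fun n => (f n)./2).
Proof.
move=> rf; apply: (@eq_recursive (fun n => natrec 0 (fun i acc => odd i + acc) (f n))).
  by move=> n; elim: (f n) => //= k ->; rewrite uphalf_half.
by apply: recursive_natrec;
  repeat first [rec_core | apply: recursive_add | apply: recursive_odd].
Qed.

(* Syntactic matching on the goal keeps unification from unfolding the Cantor pairing. *)
Ltac rec_step := lazymatch goal with
  | |- recursive (fun _ => ?k) => exact: recursive_const
  | |- recursive (fun x => x) => exact: recursive_id
  | |- recursive nfst => exact: (recursive_nfst recursive_id)
  | |- recursive nsnd => exact: (recursive_nsnd recursive_id)
  | |- recursive (fun x => S (@?f x)) => apply: recursive_S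
  | |- recursive (fun x => nfst (@?f x)) => apply: recursive_nfst
  | |- recursive (fun x => nsnd (@?f x)) => apply: recursive_nsnd
  | |- recursive (fun x => npair (@?f x) (@?g x)) => apply: recursive_npair
  | |- recursive (fun x => predn (@?f x)) => apply: recursive_pred
  | |- recursive (fun x => addn (@?f x) (@?g x)) => apply: recursive_add
  | |- recursive (fun x => subn (@?f x) (@?g x)) => apply: recursive_sub
  | |- recursive (fun x => half (@?f x)) => apply: recursive_half
  | |- recursive (fun x => nat_of_bool (odd (@?f x))) => apply: recursive_odd
  | |- recursive (fun x => nat_of_bool (leq (@?f x) (@?g x))) => apply: recursive_leq
  | |- recursive (fun x => nat_of_bool (negb (@?b x))) => apply: recursive_neg
  | |- recursive (fun x => nat_of_bool (andb (@?b x) (@?d x))) => apply: recursive_and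
  | |- recursive (fun x => nat_of_bool (orb (@?b x) (@?d x))) => apply: recursive_or
  | |- recursive (fun x => nat_of_bool (eq_op (@?f x) (@?g x))) =>
      first [apply: recursive_eqb | apply: recursive_eqn]
  | _ => first [eassumption | apply: recursive_if]
  end.

(** * Strings as numbers *)

(* [0] past the end of the string with code [a], and otherwise one more than
   the [i]-th bit. *)
Definition bit (a i : nat) : nat :=
  let v := iter i (fun b => b.-1./2) a in if v == 0 then 0 else (odd v.-1).+1.

Lemma bit_string_code s i :
  bit (string_code s) i = if i < size s then (nth false s i : nat).+1 else 0.
Proof.
elim: s i => [|b s IH] [|i] //=; rewrite /bit.
- by rewrite (_ : iter _ _ _ = 0) //; elim: i.+1 => //= j ->.
- by rewrite /= addnS /= oddD odd_double; case: b.
by rewrite iterSr addnS /= addnC half_bit_double; apply: IH.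
Qed.

(** [a.+1] codes the string with first bit [odd a] and remainder coded by [a./2]. Hence quantifiers
    over strings may range over all numbers. *)
Lemma string_code_surj a : exists s, string_code s = a.
Proof.
elim/ltn_ind: a => -[|a] IH; first by exists [::].
have [|s sP] := IH a./2.
  by rewrite ltnS -{2}(odd_double_half a) -addnn addnA leq_addl.
by exists (odd a :: s); rewrite /= sP addnS addnC odd_double_half.
Qed.

Lemma size_string_code s : size s <= string_code s.
Proof.
elim: s => //= b s IH; rewrite addnS ltnS (leq_trans IH) //.
by rewrite -addnn -addnA leq_addr.
Qed.

(** Positions below [a] suffice because a string is no longer than its code; the bound makes the
    relation recursive. *)
Definition pfx (a b : nat) : bool :=
  ~~ has (fun i => (bit a i != 0) && (bit a i != bit b i)) (iota 0 a).

Lemma pfx_bitP a b : reflect (forall i, bit a i != 0 -> bit b i = bit a i) (pfx a b).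
Proof.
apply: (iffP hasPn) => [H i|H i _]; last first.
  by rewrite negb_and negbK; case: eqP => //= /eqP /H ->; rewrite eqxx.
have [s sP] := string_code_surj a; subst a.
have [lt_is|] := ltnP i (size s); last by rewrite bit_string_code ltnNge => ->.
move=> nz; have := H i; rewrite mem_iota /= add0n nz (leq_trans lt_is) ?size_string_code //.
by move=> /(_ isT); rewrite negbK => /eqP.
Qed.

Lemma pfx_string_code s t : pfx (string_code s) (string_code t) = prefix s t.
Proof.
apply/pfx_bitP/idP => [H|/prefixP[u ->] i].
  have le_st : size s <= size t.
    case: (posnP (size s)) => [->//|s_gt0].
    have := H (size s).-1; rewrite !bit_string_code prednK // leqnn => /(_ isT).
    by case: ifP.
  rewrite prefixE -[X in _ == X](take_size s); apply/eqP.
  apply: (@eq_from_nth _ false); rewrite ?take_size ?size_takel // => i lt_is.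
  rewrite nth_take //; have := H i; rewrite !bit_string_code lt_is (leq_trans lt_is le_st).
  by move=> /(_ isT) []; case: (nth _ t i); case: (nth _ s i).
rewrite !bit_string_code size_cat nth_cat; case: ifP => // lt_is.
by rewrite (leq_trans lt_is) ?leq_addr.
Qed.

Lemma pfx_refl a : pfx a a.
Proof. by apply/pfx_bitP. Qed.

Lemma pfx_trans b a c : pfx a b -> pfx b c -> pfx a c.
Proof.
move=> /pfx_bitP ab /pfx_bitP bc; apply/pfx_bitP => i nz.
by rewrite bc ab.
Qed.

Lemma recursive_bit f g :
  recursive f -> recursive g -> recursive (fun n => bit (f n) (g n)).
Proof.
move=> rf rg.
have rv : recursive (fun n => iter (g n) (fun b => b.-1./2) (f n)).
  apply: (@eq_recursive (fun n => natrec (f n) (fun _ b => b.-1./2) (g n))).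
    by move=> n; elim: (g n) => //= k ->.
  by apply: recursive_natrec; repeat rec_step.
by rewrite /bit; repeat rec_step.
Qed.

Lemma recursive_pfx f g :
  recursive f -> recursive g -> recursive (fun n => pfx (f n) (g n)).
Proof.
move=> rf rg; apply: recursive_neg; apply: recursive_has => //.
have rf' := recursive_comp rf (recursive_nfst recursive_id).
have rg' := recursive_comp rg (recursive_nfst recursive_id).
by rewrite /recursive2; repeat first [apply: recursive_bit | rec_step].
Qed.

(** * Computable sets and genericity in terms of codes *)

Lemma recursive_decidable (B : set nat) (P : nat -> bool) :
  (forall n, B n <-> P n) -> recursive (fun n => P n) -> computable B.
Proof.
move=> BP [c cP]; exists c => x y ->.
have -> : (x \in B) = P x by apply/idP/idP => [/set_mem/BP//|/BP/mem_set].
exact: cP.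
Qed.

Lemma decidable_recursive (B : set nat) :
  computable B -> recursive (fun n => n \in B).
Proof. by move=> [c cP]; exists c => n; apply: cP. Qed.

(** The form of genericity used below: strings become codes, and the Sigma_3 set is given by its
    recursive matrix. *)
Lemma three_generic_code (G : set nat) (D : nat -> nat -> nat -> nat -> bool) :
  three_generic G ->
  recursive (fun p => D (nfst p) (nfst (nsnd p)) (nfst (nsnd (nsnd p)))
                        (nsnd (nsnd (nsnd p)))) ->
  let W a := exists x, forall y, exists z, D a x y z in
  exists n, W (string_code (initial_segment G n)) \/
    forall b, pfx (string_code (initial_segment G n)) b -> ~ W b.
Proof.
move=> gen rD W; have [|n nP] := gen (fun s => W (string_code s)).
  exists [set p | D (nfst p) (nfst (nsnd p)) (nfst (nsnd (nsnd p)))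
                     (nsnd (nsnd (nsnd p)))]%classic; split.
    exact: recursive_decidable rD.
  move=> s; rewrite /W; split=> -[x xP]; exists x => y; have [z zP] := xP y;
    by exists z; move: zP; rewrite /= !npairE.
exists n; case: nP => [Wn|nW]; [by left | right => b].
by have [t <-] := string_code_surj b; rewrite pfx_string_code; apply: nW.
Qed.

(** * Evaluation with a finite oracle *)

(* State of the search for the least [i] with [f i = 1] after [k] steps: [0] while
   it goes on, [1] once some value of [f] has been [0], and [i.+2] once [i] has
   been found. *)
Fixpoint search (f : nat -> nat) (k : nat) : nat :=
  if k is k'.+1 then
    if search f k' == 0 then
      if f k' == 0 then 1 else if f k' == 1 then k'.+2 else 0
    else search f k'
  else 0.

Lemma recursive_search (f : nat -> nat -> nat) k : recursive2 f -> recursive k ->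
  recursive (fun n => search (f n) (k n)).
Proof.
move=> rf rk; apply: (@eq_recursive (fun n => natrec 0 (fun i st =>
  if st == 0 then if f n i == 0 then 1 else if f n i == 1 then i.+2 else 0
  else st) (k n))).
  by move=> n; elim: (k n) => //= i ->.
have rf' : recursive (fun p => f (nfst p) (nfst (nsnd p))).
  by apply: (recursive2_comp rf); repeat rec_step.
by apply: recursive_natrec; repeat rec_step.
Qed.

(* Running time only bounds the unbounded searches. The value is [0] when the
   computation does not halt and [y.+1] when it halts with output [y]. *)
Fixpoint run (c : code) (a s n : nat) : nat :=
  match c with
  | Zero => 1
  | Succ => n.+2
  | Fst => (nfst n).+1
  | Snd => (nsnd n).+1
  | Oracle => bit a n
  | Pair c1 c2 =>
      if (run c1 a s n == 0) || (run c2 a s n == 0) then 0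
      else (npair (run c1 a s n).-1 (run c2 a s n).-1).+1
  | Comp c1 c2 =>
      if run c2 a s n == 0 then 0 else run c1 a s (run c2 a s n).-1
  | Prec c1 c2 =>
      natrec (run c1 a s (nfst n))
        (fun i v => if v == 0 then 0
                    else run c2 a s (npair (nfst n) (npair i v.-1)))
        (nsnd n)
  | Mu c1 =>
      (search (fun i => run c1 a s (npair n i)) s).-1
  end.

Lemma recursive_run c f g h :
  recursive f -> recursive g -> recursive h ->
  recursive (fun n => run c (f n) (g n) (h n)).
Proof.
elim: c f g h => [||||| c1 IH1 c2 IH2 | c1 IH1 c2 IH2 | c1 IH1 c2 IH2 | c1 IH1]
  f g h rf rg rh /=; try by repeat rec_step.
- exact: recursive_bit.
- by repeat first [apply: IH1 | apply: IH2 | rec_step].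
- by repeat first [apply: IH1 | apply: IH2 | rec_step].
- have rf' := recursive_comp rf (recursive_nfst recursive_id).
  have rg' := recursive_comp rg (recursive_nfst recursive_id).
  have rh' := recursive_comp rh (recursive_nfst recursive_id).
  by apply: recursive_natrec; repeat first [apply: IH1 | apply: IH2 | rec_step].
- have rf' := recursive_comp rf (recursive_nfst recursive_id).
  have rg' := recursive_comp rg (recursive_nfst recursive_id).
  have rh' := recursive_comp rh (recursive_nfst recursive_id).
  by apply: recursive_pred; apply: recursive_search => //; rewrite /recursive2;
    repeat first [apply: IH1 | rec_step].
Qed.

Lemma eval_functional O c n y z : (forall m u v, O m u -> O m v -> u = v) ->
  eval O c n y -> eval O c n z -> y = z.
Proof.
move=> fO; elim: c n y z => [||||| c1 IH1 c2 IH2 | c1 IH1 c2 IH2 | c1 IH1 c2 IH2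
  | c1 IH1] n y z /=; try by move=> -> ->.
- exact: fO.
- by move=> [u [v [/IH1 eu /IH2 ev ->]]] [u' [v' [/eu <- /ev <- ->]]].
- by move=> [u [/IH2 eu ev]] [u' [/eu <-]]; apply: IH1.
- elim: (nsnd n) y z => [|k IH] y z /=; first exact: IH1.
  by move=> [u [/IH eu ev]] [u' [/eu <-]]; apply: IH2.
- move=> [y0 ypos] [z0 zpos]; case: (ltngtP y z) => // [/zpos|/ypos] [k ek].
    by have := IH1 _ _ _ y0 ek.
  by have := IH1 _ _ _ z0 ek.
Qed.

Lemma chi_functional A m u v : chi A m u -> chi A m v -> u = v.
Proof. by move=> -> ->. Qed.

(** A query past the end of [a] yields [0], that is, no output, so only the bits that [a] has must
    agree with [G]. *)
Lemma run_sound (G : set nat) c a s n y :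
  (forall x v, bit a x = v.+1 -> v = (x \in G)) ->
  run c a s n = y.+1 -> eval (chi G) c n y.
Proof.
move=> aG; elim: c n y => [||||| c1 IH1 c2 IH2 | c1 IH1 c2 IH2 | c1 IH1 c2 IH2
  | c1 IH1] n y /=; try by move=> [<-].
- exact: aG.
- case E1: (run c1 a s n) => [|u]; case E2: (run c2 a s n) => [|v] //= [<-].
  by exists u, v; split; [apply: IH1 | apply: IH2 |].
- case E: (run c2 a s n) => [|u] //= E1.
  by exists u; split; [apply: IH2 | apply: IH1].
- elim: (nsnd n) y => [|k IH] y /=; first exact: IH1.
  case E: natrec => [|u] //= E1.
  by exists u; split; [apply: IH | apply: IH2].
- set st := search _.
  (* Invariant of the search: a reported index is a value of [Mu c1], state [0] means that all
     values so far are positive outputs, and state [1] asserts nothing. *)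
  suff H k : if st k is v.+1 then
      if v is y'.+1 then eval (chi G) (Mu c1) n y' else True
    else forall i, i < k -> exists j, eval (chi G) c1 (npair n i) j.+1.
    by have := H s; case: (st s) => [|[|v]] //= Hv [<-].
  elim: k => [|k] //; rewrite {2}/st /= -/st; case: (st k) => [|v] //= IH.
  case E: (run c1 a s (npair n k)) => [|[|v]] //=.
    by split=> //; apply: IH1.
  move=> i; rewrite ltnS leq_eqVlt => /predU1P[->|/IH//].
  by exists v; apply: IH1.
Qed.

(** One threshold serves both for the search bound and for the length of correct oracle, so finitely
    many such properties combine by taking a maximum. *)
Definition eventually (G : set nat) (P : nat -> nat -> Prop) :=
  exists s0, forall s a, s0 <= s ->
    (forall x, x < s0 -> bit a x = (x \in G).+1) -> P s a.

Lemma eventually_and G P Q : eventually G P -> eventually G Q ->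
  eventually G (fun s a => P s a /\ Q s a).
Proof.
move=> [p pP] [q qP]; exists (maxn p q) => s a; rewrite geq_max => /andP[ps qs] aG.
split; [apply: pP | apply: qP] => // x lt_x; apply: aG;
  by rewrite (leq_trans lt_x) ?leq_maxl ?leq_maxr.
Qed.

Lemma eventually_mono G (P Q : nat -> nat -> Prop) :
  (forall s a, P s a -> Q s a) -> eventually G P -> eventually G Q.
Proof. by move=> PQ [p pP]; exists p => s a ps aG; apply/PQ/pP. Qed.

Lemma eventually_bounded G k (P : nat -> nat -> nat -> Prop) :
  (forall i, i < k -> eventually G (P i)) ->
  eventually G (fun s a => forall i, i < k -> P i s a).
Proof.
elim: k => [|k IH] H; first by exists 0.
have := eventually_and (IH (fun i lt_ik => H i (ltnW lt_ik))) (H k (ltnSn k)).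
apply: eventually_mono => s a [Pk Pi] i.
by rewrite ltnS leq_eqVlt => /predU1P[->|/Pk].
Qed.

(** By induction on the program: a halting computation depends on finitely many subcomputations,
    also for [Mu], where they are those at the arguments up to the output, so a common threshold
    exists. *)
Lemma run_complete (G : set nat) c n y :
  eval (chi G) c n y -> eventually G (fun s a => run c a s n = y.+1).
Proof.
elim: c n y => [||||| c1 IH1 c2 IH2 | c1 IH1 c2 IH2 | c1 IH1 c2 IH2
  | c1 IH1] n y /=; try by move=> ->; exists 0.
- by move=> ->; exists n.+1 => s a _; apply.
- move=> [u [v [/IH1 H1 /IH2 H2 ->]]]; apply: eventually_mono (eventually_and H1 H2).
  by move=> s a [-> ->].
- move=> [u [/IH2 H2 /IH1 H1]]; apply: eventually_mono (eventually_and H1 H2).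
  by move=> s a [E1 ->].
- elim: (nsnd n) y => [|k IH] y /=; first exact: IH1.
  move=> [u [/IH H1 /IH2 H2]]; apply: eventually_mono (eventually_and H1 H2).
  by move=> s a [-> E].
- move=> [/IH1 y0 ypos].
  have : eventually G (fun s a =>
      forall i, i < y -> exists k, run c1 a s (npair n i) = k.+2).
    apply: eventually_bounded => i /ypos [k /IH1]; apply: eventually_mono => s a E.
    by exists k.
  move=> /(eventually_and y0) H.
  have ys : eventually G (fun s _ => y < s) by exists y.+1.
  apply: eventually_mono (eventually_and ys H) => s a [lt_ys [E0 Epos]].
  set st := search _.
  (* Values of [run] before [y] are at least [2] and keep the state at [0]; the value [1] at [y]
     then sets it to [y.+2] for good. *)
  have st_le k : k <= y -> st k = 0.
    elim: k => [|k IH] // lt_ky; rewrite /st /= -/st IH ?(ltnW lt_ky) //=.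
    by have [j ->] := Epos k lt_ky.
  have st_gt k : y < k -> st k = y.+2.
    elim: k => [|k IH] //; rewrite ltnS leq_eqVlt /st /= -/st.
    by move=> /predU1P[<-|/IH ->] //; rewrite st_le // E0.
  by rewrite st_gt.
Qed.

Lemma bit_initial_segment G n i :
  bit (string_code (initial_segment G n)) i = if i < n then (i \in G).+1 else 0.
Proof.
rewrite bit_string_code size_mkseq; case: ifP => // lt_in.
by rewrite nth_mkseq.
Qed.

Lemma pfx_initial_segment G m n : m <= n ->
  pfx (string_code (initial_segment G m)) (string_code (initial_segment G n)).
Proof.
move=> le_mn; apply/pfx_bitP => i; rewrite !bit_initial_segment.
by case: ifP => // lt_im _; rewrite (leq_trans lt_im).
Qed.

Lemma run_initial_segment_sound G c n s m y :
  run c (string_code (initial_segment G n)) s m = y.+1 -> eval (chi G) c m y.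
Proof.
apply: run_sound => x v; rewrite bit_initial_segment; case: ifP => // _.
by case=> <-.
Qed.

Lemma run_initial_segment_complete G c m y j : eval (chi G) c m y ->
  exists n s, j <= n /\ run c (string_code (initial_segment G n)) s m = y.+1.
Proof.
move=> /run_complete[s0 H]; exists (maxn j s0), s0; split; first exact: leq_maxl.
apply: H => // x lt_x; rewrite bit_initial_segment.
by rewrite (leq_trans lt_x) ?leq_maxr.
Qed.

(** * Finite and infinite sets of numbers *)

Lemma finite_set_ub (A : set nat) : finite_set A -> exists k, forall m, A m -> m <= k.
Proof.
move=> /finite_seqP[s ->]; exists (\max_(i <- s) i) => m ms.
exact: (@leq_bigmax_seq _ s xpredT id m ms isT).
Qed.

Lemma infinite_setP (A : set nat) :
  infinite_set A <-> forall k, exists2 m, k < m & A m.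
Proof.
split=> [infA k|H /finite_set_ub[k kP]]; last first.
  by have [m lt_km /kP] := H k; rewrite leqNgt lt_km.
apply: contrapT => H; apply: infA; apply: (sub_finite_set _ (finite_II k.+1)).
move=> m Am /=; rewrite ltnS leqNgt; apply/negP => lt_km.
by apply: H; exists m.
Qed.

(** * Forcing *)

Section Forcing.
Variables (R : nat -> set nat) (c : code).

(** The value [2] of [run] stands for output [1]: the string [a] forces [m] into the set computed by
    [c]. *)
Definition hit (a t m : nat) : bool := run c a t m == 2.

Definition decides (n a k : nat) (side : bool) :=
  forall b t m, pfx a b -> k < m -> hit b t m -> (m \in R n) = side.

(** All that the construction retains of [G]: two density properties above [a0] that mention neither
    [G] nor the set computed from it. *)
Definition good (a0 : nat) :=
  (forall b k, pfx a0 b -> exists d t m, [/\ pfx b d, k < m & hit d t m]) /\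
  (forall b n, pfx a0 b -> exists d k side, pfx b d /\ decides n d k side).

Let R_rec := recursive2 (fun n m => m \in R n).

Lemma recursive_hit f g h : recursive f -> recursive g -> recursive h ->
  recursive (fun n => hit (f n) (g n) (h n)).
Proof. by move=> *; apply: recursive_eqn; [apply: recursive_run | rec_step]. Qed.

Lemma recursive_mem f g : R_rec -> recursive f -> recursive g ->
  recursive (fun n => g n \in R (f n)).
Proof. exact: recursive2_comp. Qed.

Ltac frec := rewrite /recursive2; repeat lazymatch goal with
  | |- recursive (fun x => nat_of_bool (hit (@?f x) (@?g x) (@?h x))) =>
      apply: recursive_hit
  | |- recursive (fun x => nat_of_bool (pfx (@?f x) (@?g x))) => apply: recursive_pfx
  | |- recursive (fun x => nat_of_bool (in_mem (@?f x) (@?A x))) => apply: recursive_mem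
  | _ => rec_step
  end.

(** * Consequences of genericity *)

Section Generic.
Variables (G C : set nat).
Hypothesis cC : forall x y, chi C x y -> eval (chi G) c x y.
Local Notation seg n := (string_code (initial_segment G n)).

Lemma hit_initial_segment n t m : hit (seg n) t m -> m \in C.
Proof.
move=> /eqP /run_initial_segment_sound e1.
have := eval_functional (@chi_functional G) e1 (cC erefl).
by case: (m \in C).
Qed.

Lemma mem_hit j m : m \in C -> exists n t, j <= n /\ hit (seg n) t m.
Proof.
move=> mC; have e1 := cC (erefl (nat_of_bool (m \in C))).
have [n [t [le_jn E]]] := run_initial_segment_complete j e1.
by exists n, t; rewrite /hit E mC.
Qed.

(** The strings with no hit above some [k] in any extension form a Sigma_2 set. Since [C] is
    infinite, no segment of [G] lies in it, so some segment has no extension in it. *)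
Lemma generic_hits : infinite_set C -> three_generic G ->
  exists n, forall b k, pfx (seg n) b ->
    exists d t m, [/\ pfx b d, k < m & hit d t m].
Proof.
move=> /infinite_setP infC gen.
have [|n] := three_generic_code (D := fun a k y _ => ~~ [&& pfx a (nfst y),
  k < nsnd (nsnd y) & hit (nfst y) (nfst (nsnd y)) (nsnd (nsnd y))]) gen.
  by frec.
case=> [[k kP]|H]; last first.
  exists n => b k pb; apply: contrapT => nex; apply: (H b pb).
  exists k => y; exists 0; apply/negP => /and3P[p1 p2 p3].
  by apply: nex; exists (nfst y), (nfst (nsnd y)), (nsnd (nsnd y)).
have [m lt_km /mem_set mC] := infC k.
have [l [t [le_nl hl]]] := mem_hit n mC.
have [_] := kP (npair (seg l) (npair t m)).
by rewrite !npairE pfx_initial_segment // lt_km hl.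
Qed.

(** Above some [k] the set [C] lies on one side of [R n]. The strings with a hit above [k] on the
    other side form a Sigma_1 set that no segment of [G] enters; a segment without extensions there
    decides [R n]. *)
Lemma generic_decides_one n : R_rec -> cohesive R C -> three_generic G ->
  exists l k side, decides n (seg l) k side.
Proof.
move=> rR [_ /(_ n) coh] gen.
have [k [side kP]] : exists k side, forall m, k < m -> m \in C -> (m \in R n) = side.
  case: coh => /finite_set_ub[k kP]; exists k; [exists true | exists false] => m;
    rewrite ltnNge => /negP lt_km /set_mem Cm.
    by apply: mem_set; apply: contrapT => nR; apply/lt_km/kP.
  by apply/negP => /set_mem Rm; apply/lt_km/kP; split=> // nR; apply: nR.
have [|l] := three_generic_code (D := fun a x _ _ => [&& k < nsnd x,
  hit a (nfst x) (nsnd x) & (nsnd x \in R n) != side]) gen.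
  by frec.
case=> [[x /(_ 0) [_ /and3P[lt_kx /hit_initial_segment xC]]]|H].
  by rewrite kP ?eqxx.
exists l, k, side => b t m pb lt_km h; apply: contrapT => /eqP neq; apply: (H b pb).
by exists (npair t m) => _; exists 0; rewrite !npairE lt_km h neq.
Qed.

Lemma generic_decides : R_rec -> cohesive R C -> three_generic G ->
  exists l, forall b n, pfx (seg l) b ->
    exists d k side, pfx b d /\ decides n d k side.
Proof.
move=> rR coh gen.
(* [y] codes a string, a bound and a side, given as a parity; [z] codes a refuting extension, a
   search bound and an element on the wrong side. *)
pose D a n y z := pfx a (nfst y) ==> [&& pfx (nfst y) (nfst z),
  nfst (nsnd y) < nsnd (nsnd z), hit (nfst z) (nfst (nsnd z)) (nsnd (nsnd z)) &
  (nsnd (nsnd z) \in R n) != odd (nsnd (nsnd y))].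
have [|l] := three_generic_code (D := D) gen.
  apply: (@eq_recursive (fun p => ~~ pfx (nfst p) (nfst (nfst (nsnd (nsnd p)))) ||
    [&& pfx (nfst (nfst (nsnd (nsnd p)))) (nfst (nsnd (nsnd (nsnd p)))),
      nfst (nsnd (nfst (nsnd (nsnd p)))) < nsnd (nsnd (nsnd (nsnd (nsnd p)))),
      hit (nfst (nsnd (nsnd (nsnd p)))) (nfst (nsnd (nsnd (nsnd (nsnd p)))))
          (nsnd (nsnd (nsnd (nsnd (nsnd p))))) &
      (nsnd (nsnd (nsnd (nsnd (nsnd p)))) \in R (nfst (nsnd p)))
        != odd (nsnd (nsnd (nfst (nsnd (nsnd p)))))])).
    by move=> p; rewrite /D implybE.
  by frec.
case=> [[n nP]|H].
  have [j [k [side jP]]] := generic_decides_one n rR coh gen.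
  (* This segment extends [seg l] and also [seg j], which decides [R n], so no [z] can refute it. *)
  have := nP (npair (seg (maxn l j)) (npair k side)).
  case=> z; rewrite /D !npairE pfx_initial_segment ?leq_maxl //= => /and4P[p1 p2 p3].
  rewrite (jP _ _ _ _ p2 p3) ?oddb ?eqxx //.
  by apply: pfx_trans p1; rewrite pfx_initial_segment ?leq_maxr.
exists l => b n pb; apply: contrapT => nex; apply: (H b pb); exists n => y.
case pby: (pfx b (nfst y)); last by exists 0; rewrite /D pby.
apply: contrapT => nz; apply: nex.
exists (nfst y), (nfst (nsnd y)), (odd (nsnd (nsnd y))); split=> // d t m pd lt_m h.
apply: contrapT => /eqP neq; apply: nz; exists (npair d (npair t m)).
by rewrite /D pby !npairE pd lt_m h neq.
Qed.

Lemma generic_good : R_rec -> cohesive R C -> three_generic G -> exists a, good a.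
Proof.
move=> rR coh gen.
have [l1 H1] := generic_hits coh.1 gen; have [l2 H2] := generic_decides rR coh gen.
exists (seg (maxn l1 l2)); split=> b k pb; [apply: H1 | apply: H2];
  by apply: pfx_trans pb; rewrite pfx_initial_segment ?leq_maxl ?leq_maxr.
Qed.

End Generic.

(** * Construction of the computable cohesive set *)

Section Construction.
Variable a0 : nat.
Hypotheses (rR : R_rec) (a0_good : good a0).

(* A guess [p] codes a string, a bound and a side; [refutes n p z] means that [z]
   codes a witness against [decides] for this triple. *)
Definition refutes (n p z : nat) : bool :=
  [&& pfx (nfst p) (nfst z), nfst (nsnd p) < nsnd (nsnd z),
      hit (nfst z) (nfst (nsnd z)) (nsnd (nsnd z)) &
      (nsnd (nsnd z) \in R n) != odd (nsnd (nsnd p))].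

Definition plausible (s n a p : nat) : bool :=
  pfx a (nfst p) && ~~ has (refutes n p) (iota 0 s).

Definition guess (s n a : nat) : nat := mu (plausible s n a).

(* The stage [s] approximation to an increasing sequence of strings the
   [n.+1]-st of which decides [R n]. *)
Definition approx (s n : nat) : nat := natrec a0 (fun i a => nfst (guess s i a)) n.

(** The bound [s] is safe at stage [s]: a code below [s] has its element below [s] and cannot refute
    it. So the search for a guess always ends. *)
Lemma guess_exists s n a : exists p, plausible s n a p.
Proof.
exists (npair a (npair s 0)); rewrite /plausible !npairE pfx_refl /=.
apply/hasPn => z; rewrite mem_iota /refutes !npairE /= add0n => lt_zs.
rewrite ltnNge (leq_trans (nsnd_le _)) ?(leq_trans (nsnd_le _)) ?andbF //.
exact: ltnW.
Qed.

Lemma pfx_approx s n m : n <= m -> pfx (approx s n) (approx s m).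
Proof.
move=> /subnKC <-; elim: (m - n) => [|i IH]; first by rewrite addn0 pfx_refl.
apply: pfx_trans IH _; rewrite addnS /=.
have [p /muP[/andP[ext _] _]] := guess_exists s (n + i) (approx s (n + i)).
exact: ext.
Qed.

(** The least correct guess is never refuted, while each of the finitely many smaller numbers either
    fails to extend [a] or is refuted from some stage on. *)
Lemma guess_limit n a : (exists d k side, pfx a d /\ decides n d k side) ->
  exists p s0, [/\ forall s, s0 <= s -> guess s n a = p, pfx a (nfst p) &
    decides n (nfst p) (nfst (nsnd p)) (odd (nsnd (nsnd p)))].
Proof.
pose Q p := `[< pfx a (nfst p) /\
  decides n (nfst p) (nfst (nsnd p)) (odd (nsnd (nsnd p))) >].
move=> [d [k [side [pd dd]]]].
have exQ : exists p, Q p.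
  by exists (npair d (npair k side)); apply/asboolP; rewrite !npairE oddb.
case: (ex_minnP exQ) => p /asboolP[ext dec] min_p.
have [s0 s0P] : exists s0, forall s, s0 <= s -> forall q, q < p -> ~~ plausible s n a q.
  suff : forall k, k <= p -> exists s0, forall s, s0 <= s ->
    forall q, q < k -> ~~ plausible s n a q by move=> /(_ p (leqnn p)).
  elim=> [|q IH] lt_qp; first by exists 0.
  have [s1 s1P] := IH (ltnW lt_qp).
  have [s2 s2P] : exists s2, forall s, s2 <= s -> ~~ plausible s n a q.
    rewrite /plausible; case pq: (pfx a (nfst q)); last by exists 0.
    have nQ : ~ (pfx a (nfst q) /\
        decides n (nfst q) (nfst (nsnd q)) (odd (nsnd (nsnd q)))).
      by move=> /asboolP/min_p; rewrite leqNgt lt_qp.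
    apply: contrapT => nex; apply: nQ; split=> //.
    move=> b t m pb lt_m h; apply: contrapT => /eqP neq; apply: nex.
    (* Stage [s] checks the codes below [s], hence the successor. *)
    exists (npair b (npair t m)).+1 => s lt_s; rewrite /= negbK; apply/hasP.
    exists (npair b (npair t m)); first by rewrite mem_iota.
    by rewrite /refutes !npairE pb lt_m h neq.
  exists (maxn s1 s2) => s; rewrite geq_max => /andP[s1s s2s] r.
  by rewrite ltnS leq_eqVlt => /predU1P[->|/s1P]; [apply: s2P | apply].
exists p, s0; split=> // s le_s.
have plp : plausible s n a p.
  rewrite /plausible ext /=; apply/hasPn => z _; apply/and4P => -[p1 p2 p3].
  by rewrite (dec _ _ _ p1 p2 p3) eqxx.
have [plg le_gp] := muP plp; apply/eqP; rewrite eqn_leq le_gp leqNgt.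
by apply/negP => /(s0P s le_s) /negP; apply.
Qed.

(** Once the chain of length [n] has settled at [a], the next guess is made for a fixed string and
    settles too; earlier decisions pass to extensions. *)
Lemma approx_limit n : exists a s0, [/\ pfx a0 a, forall s, s0 <= s -> approx s n = a &
  forall i, i < n -> exists k side, decides i a k side].
Proof.
elim: n => [|n [a [s0 [pa lim dec]]]].
  by exists a0, 0; split=> //; apply: pfx_refl.
have [p [s1 [glim ext pdec]]] := guess_limit (a0_good.2 a n pa).
exists (nfst p), (maxn s0 s1); split=> [|s|i].
- exact: pfx_trans ext.
- by rewrite geq_max => /andP[/lim E /glim <-]; rewrite -E.
rewrite ltnS leq_eqVlt => /predU1P[->|/dec [k [side H]]].
  by exists (nfst (nsnd p)), (odd (nsnd (nsnd p))).
by exists k, side => b t m pb; apply: H; apply: pfx_trans pb.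
Qed.

(** Extending the chain of length [s] at stage [s] makes all but finitely many choices respect each
    settled link. *)
Definition suitable (s m q : nat) : bool :=
  [&& pfx (approx s s) (nfst q), m < nsnd (nsnd q) &
      hit (nfst q) (nfst (nsnd q)) (nsnd (nsnd q))].

Definition next (s m : nat) : nat := nsnd (nsnd (mu (suitable s m))).

Definition elt (n : nat) : nat := natrec 0 next n.

Lemma suitable_mu s m : suitable s m (mu (suitable s m)).
Proof.
have [d [t [k [pd lt_mk h]]]] := a0_good.1 _ m (pfx_approx s (leq0n s)).
have /muP[] // : suitable s m (npair d (npair t k)).
by rewrite /suitable !npairE pd lt_mk.
Qed.

Lemma elt_ltS n : elt n < elt n.+1.
Proof. by have /and3P[] := suitable_mu n (elt n). Qed.

Lemma elt_ge n : n <= elt n.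
Proof. by elim: n => // n IH; apply: leq_ltn_trans IH (elt_ltS n). Qed.

(** [elt 0] is only the starting bound and need not come from a hit, hence the shift. *)
Definition elts : set nat := [set m | exists n, m = elt n.+1]%classic.

Lemma recursive_approx f g : recursive f -> recursive g ->
  recursive (fun n => approx (f n) (g n)).
Proof.
move=> rf rg; have rf' := recursive_comp rf (recursive_nfst recursive_id).
have rf'' := recursive_comp rf' (recursive_nfst recursive_id).
apply: recursive_natrec => //; first exact: recursive_const.
apply: recursive_nfst; rewrite /guess; apply: recursive_mu => [n|].
  exact: guess_exists.
rewrite /recursive2 /plausible; apply: recursive_and; first by frec.
apply: recursive_neg; apply: recursive_has => //.
by rewrite /refutes; frec.
Qed.

Lemma recursive_elt f : recursive f -> recursive (fun n => elt (f n)).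
Proof.
move=> rf; apply: recursive_natrec => //; first exact: recursive_const.
rewrite /next; do 2!apply: recursive_nsnd; apply: recursive_mu => [n|].
  by eexists; apply: suitable_mu.
rewrite /recursive2 /suitable; apply: recursive_and; last by frec.
by apply: recursive_pfx; last frec; apply: recursive_approx; frec.
Qed.

(** The enumeration is increasing, so [m] can only appear as [elt n.+1] with [n < m], and a bounded
    search decides membership. *)
Lemma elts_computable : computable elts.
Proof.
apply: (@recursive_decidable _ (fun m => has (fun n => elt n.+1 == m) (iota 0 m))).
  move=> m; split=> [[n ->]|/hasP[n _ /eqP <-]]; last by exists n.
  apply/hasP; exists n => //; rewrite mem_iota /=; exact: elt_ge.
apply: recursive_has; last exact: recursive_id.
rewrite /recursive2; apply: recursive_eqn; last by frec.
by apply: recursive_elt; frec.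
Qed.

Lemma elts_cohesive : cohesive R elts.
Proof.
split.
  apply/infinite_setP => k; exists (elt k.+1); last by exists k.
  exact: elt_ge.
move=> n; have [a [s0 [pa lim /(_ n (ltnSn n)) [k [side dec]]]]] := approx_limit n.+1.
(* From stage [N] on the chain has a link for [R n], this link has settled at [a], and new elements
   exceed [k]. *)
pose N := maxn (maxn s0 k) n.+1.
have eltR m : N <= m -> (elt m.+1 \in R n) = side.
  rewrite !geq_max => /andP[/andP[le_s0 le_k] lt_n].
  have /and3P[pm lt_m h] := suitable_mu m (elt m).
  apply: (dec _ _ _ _ _ h); last by rewrite (leq_ltn_trans _ lt_m) // (leq_trans le_k) ?elt_ge.
  by apply: pfx_trans pm; rewrite -(lim m) // pfx_approx.
(* Exceptions occur only among the first [N] enumerated elements. *)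
have almost (Y : set nat) : (forall m, N <= m -> Y (elt m.+1)) -> almost_subset elts Y.
  move=> HY; apply: (sub_finite_set _ (finite_image (fun m => elt m.+1) (finite_II N))).
  move=> _ [[m ->] nY]; exists m => //=; rewrite ltnNge; apply/negP => /HY.
  exact: nY.
case: side {dec} eltR => eltR; [left | right]; apply: almost => m /eltR.
  by move=> /set_mem.
by move=> nR /mem_set; rewrite nR.
Qed.

End Construction.
End Forcing.

Theorem theorem2p1 (R : nat -> set nat)
    (R_computable : computable_seq R)
    (no_computable_cohesive : ~ exists C : set nat, cohesive R C /\ computable C) :
  forall G : set nat, three_generic G ->
    ~ exists C : set nat, cohesive R C /\ turing_le C G.
Proof.
move=> G gen [C [coh [c cC]]]; apply: no_computable_cohesive.
have rR : recursive2 (fun n m => m \in R n).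
  apply: eq_recursive (decidable_recursive R_computable) => p.
  by congr nat_of_bool; apply/idP/idP => /set_mem H; apply/mem_set.
have [a0 a0_good] := generic_good cC rR coh gen.
exists (elts R c a0); split; [exact: elts_cohesive | exact: elts_computable].
Qed.
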